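(* Let $n\ge1$ and $\lambda\in\mathcal{S}_n(q)$. Let $U_{n-1}$ be embedded in $U_n$ as the subgroup $\{u\in U_n: u_{1j}=0\text{ for all }j>1\}$. Then $$\mathrm{Res}^{U_n}_{U_{n-1}}(\chi^\lambda)=\begin{cases}\chi^\lambda\ast_1\chi^{\{k\}}, & \text{if } \lambda_{1k}\ne0 \text{ for some } k>1,\\ \chi^\lambda, & \text{otherwise,}\end{cases}$$ where $\chi^\lambda$ on the left is the supercharacter of $U_n$ attached to $\lambda$ and the characters on the right (including the expansion of $\chi^\lambda\ast_1\chi^{\{k\}}$) are supercharacters of the subgroup $U_{n-1}$.
   Context: Let $\mathbb{F}_q$ be a finite field with $q$ elements and $U_n$ the group of $n\times n$ unipotent upper-triangular matrices over $\mathbb{F}_q$. Let $U$ be either $U_n$ or its subgroup $\{u\in U_n: u_{1j}=0\text{ for all }j>1\}\cong U_{n-1}$, and let $\mathfrak{n}=\{u-1:u\in U\}$ with dual space $\mathfrak{n}^*$ of $\mathbb{F}_q$-linear functionals. $U$ acts on $\mathfrak{n}^*$ by $(u\lambda v)(x-1)=\lambda(u^{-1}(x-1)v^{-1})$ for $u,v,x\in U$. Fix a nontrivial homomorphism $\theta:\mathbb{F}_q^+\to\mathbb{C}^\times$. The supercharacter of $U$ attached to $\lambda\in\mathfrak{n}^*$ is $$\chi^\lambda(x)=\frac{|U\lambda|}{|U\lambda U|}\sum_{\mu\in U\lambda U}\theta(-\mu(x-1)),\qquad x\in U.$$ Functionals are identified with strictly upper-triangular matrices via $\lambda_{ij}=\lambda(e_{ij})$,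 where $e_{ij}\in\mathfrak{n}$ is the matrix unit, with zero entries where $e_{ij}\notin\mathfrak{n}$; a strictly upper-triangular $n\times n$ matrix with zero first row is thus also a functional for the subgroup $U_{n-1}$. $\mathcal{S}_n(q)$ is the set of strictly upper-triangular $n\times n$ matrices over $\mathbb{F}_q$ (functionals for $U_n$) with at most one nonzero entry in every row and in every column. For a strictly upper-triangular matrix $\lambda$ with at most one nonzero entry in each row, and integers $1\le i\le k\le n$, define recursively the formal linear combination of matrices $$\lambda\ast_i\{k\}=\begin{cases}\lambda, & \text{if } i=k,\\ q\,(\lambda\ast_{i+1}\{k\}), & \text{if } \lambda_{il}\ne0 \text{ for some } l>k,\\ \lambda|_{\lambda_{ik}=0}\ast_{i+1}\{k\}, & \text{if } \lambda_{ik}\ne0,\\ \displaystyle\lambda\ast_{i+1}\{k\}+\sum_{t\in\mathbb{F}_q^\times}\lambda|_{\lambda_{ik}=t,\ \lambda_{ij}=0}\ast_{i+1}\{j\}, & \text{if } \lambda_{ij}\ne0 \text{ for some } i<j<k,\\ \displaystyle\lambda\ast_{i+1}\{k\}+\sum_{t\in\mathbb{F}_q^\times}\lambda|_{\lambda_{ik}=t}, & \text{if } \lambda_{ij}=0 \text{ for all } j>i,\end{cases}$$ where the last four cases assume $i<k$, and $\lambda|_{\lambda_{ab}=s,\dots}$ denotes the matrix obtained from $\lambda$ by changing the indicated entries to the indicated values. The product is extended to supercharacters by: $\chi^\mu\ast_i\chi^{\{k\}}=\sum_\nu c_{\mu k}^\nu\chi^\nu$ if $\mu\ast_i\{k\}=\sum_\nu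 c_{\mu k}^\nu\,\nu$. *)

(* Defs.v *)
From mathcomp Require Import all_boot all_order all_algebra all_fingroup.

Set Implicit Arguments.
Unset Strict Implicit.
Unset Printing Implicit Defensive.

Import GRing.Theory.
Local Open Scope ring_scope.

(* Rows and columns are numbered from 0: the entry (i, j) of the usual        *)
(* 1-based convention is the entry (i - 1, j - 1) here.                        *)

Section Unitriangular.

Variables (F : finFieldType) (n : nat).

Definition unitri_set : {set {'GL_n.+1[F]}} :=
  [set u : {'GL_n.+1[F]} |
    [forall i : 'I_n.+1, forall j : 'I_n.+1,
      (j <= i)%N ==> (GLval u i j == (i == j)%:R)]].

Lemma unitriP (u : {'GL_n.+1[F]}) :
  reflect (forall i j : 'I_n.+1, (j <= i)%N -> GLval u i j = (i == j)%:R)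
          (u \in unitri_set).
Proof.
rewrite inE; apply: (iffP forallP) => [H i j le_ji | H i].
  by move/forallP/(_ j)/implyP/(_ le_ji)/eqP: (H i).
by apply/forallP=> j; apply/implyP=> le_ji; rewrite H.
Qed.

Lemma unitri_group_set : group_set unitri_set.
Proof.
apply/group_setP; split=> [|u v /unitriP Hu /unitriP Hv].
  by apply/unitriP=> i j _; rewrite GL_1E mxE.
apply/unitriP=> i j le_ji; rewrite GL_MxE mxE (bigD1 i) //= big1 => [|k ne_ki].
  by rewrite addr0 Hu // eqxx mul1r Hv.
have [lt_ki|lt_ik|/val_inj eq_ki] := ltngtP k i; last by rewrite eq_ki eqxx in ne_ki.
  by rewrite Hu 1?ltnW // eq_sym (negbTE ne_ki) mul0r.
rewrite Hv ?(leq_trans le_ji (ltnW lt_ik)) //.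
by rewrite -val_eqE /= (gtn_eqF (leq_ltn_trans le_ji lt_ik)) mulr0.
Qed.

Definition unitri : {group {'GL_n.+1[F]}} := Group unitri_group_set.

(* The copy of the unitriangular group of size n in the one of size n.+1.     *)
Definition unitri1_set : {set {'GL_n.+1[F]}} :=
  [set u in unitri_set |
    [forall j : 'I_n.+1, (0 < j)%N ==> (GLval u ord0 j == 0)]].

Lemma unitri1P (u : {'GL_n.+1[F]}) :
  reflect (u \in unitri_set /\
           forall j : 'I_n.+1, (0 < j)%N -> GLval u ord0 j = 0)
          (u \in unitri1_set).
Proof.
rewrite [u \in unitri1_set]inE; apply: (iffP andP) => -[Uu H]; split=> //.
  by move=> j lt0j; move/forallP/(_ j)/implyP/(_ lt0j)/eqP: H.
by apply/forallP=> j; apply/implyP=> lt0j; rewrite H.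
Qed.

Lemma unitri1_group_set : group_set unitri1_set.
Proof.
apply/group_setP; split=> [|u v /unitri1P[Uu Hu] /unitri1P[Uv Hv]].
  apply/unitri1P; split; first exact: (group1 unitri).
  by move=> j lt0j; rewrite GL_1E mxE -val_eqE /= ltn_eqF.
apply/unitri1P; split; first exact: (@groupM _ unitri).
move=> j lt0j; rewrite GL_MxE mxE (bigD1 ord0) //= big1 => [|k ne_k0].
  by rewrite addr0 Hv ?mulr0.
by rewrite Hu ?mul0r // lt0n; apply: contraNneq ne_k0 => k0; apply/eqP/val_inj.
Qed.

Definition unitri1 : {group {'GL_n.+1[F]}} := Group unitri1_group_set.

End Unitriangular.

Section Supercharacters.

Variables (F : finFieldType) (n : nat).
Implicit Types (G : {group {'GL_n.+1[F]}}) (u v x : {'GL_n.+1[F]}).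
Implicit Types (lam mu y : 'M[F]_n.+1).

Definition nilset G : {set 'M[F]_n.+1} := [set GLval u - 1%:M | u in G].

(* The functional attached to a matrix lam: it maps delta_mx i j to lam i j.  *)
Definition pairing lam (y : 'M[F]_n.+1) : F := \sum_i \sum_j lam i j * y i j.

(* For G one of the two groups above, nilset G is spanned by the matrix units *)
(* it contains, so a functional on it is the same thing as a matrix that      *)
(* vanishes outside the positions of these units; act G u lam v is the matrix *)
(* of y |-> lam (u^-1 y v^-1).                                                 *)
Definition act G u lam v : 'M[F]_n.+1 :=
  \matrix_(i, j)
    if delta_mx i j \in nilset G
    then pairing lam (GLval u^-1 *m delta_mx i j *m GLval v^-1) else 0.

Definition lorbit G lam : {set 'M[F]_n.+1} := [set act G u lam 1%g | u in G].

Definition biorbit G lam : {set 'M[F]_n.+1} :=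
  [set act G u lam v | u in G, v in G].

Lemma pairing_act G u v lam y :
    (forall i j, y i j != 0 -> delta_mx i j \in nilset G) ->
  pairing (act G u lam v) y = pairing lam (GLval u^-1 *m y *m GLval v^-1).
Proof.
move=> Gy.
have pairingD : {morph pairing lam : a b / a + b}.
  move=> a b; rewrite /pairing -big_split; apply: eq_bigr => i _ /=.
  by rewrite -big_split; apply: eq_bigr => j _ /=; rewrite mxE mulrDr.
have pairing0 : pairing lam 0 = 0.
  by rewrite /pairing !big1 // => i _; rewrite big1 // => j _; rewrite mxE mulr0.
have pairingZ c a : pairing lam (c *: a) = c * pairing lam a.
  rewrite /pairing mulr_sumr; apply: eq_bigr => i _.
  by rewrite mulr_sumr; apply: eq_bigr => j _; rewrite mxE mulrCA.
rewrite {2}[y]matrix_sum_delta mulmx_sumr mulmx_suml (big_morph _ pairingD pairing0).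
apply: eq_bigr => i _.
rewrite mulmx_sumr mulmx_suml (big_morph _ pairingD pairing0).
apply: eq_bigr => j _; rewrite -scalemxAr -scalemxAl pairingZ mxE mulrC.
by have [->|/Gy->] := eqVneq (y i j) 0; rewrite ?mul0r.
Qed.

Lemma nilset_unitriP y :
  reflect (forall i j : 'I_n.+1, (j <= i)%N -> y i j = 0)
          (y \in nilset (unitri F n)).
Proof.
apply: (iffP imsetP) => [[u /unitriP Uu ->] i j le_ji | y0].
  by rewrite !mxE Uu // subrr.
have det1y : \det (1%:M + y) = 1.
  rewrite -det_tr det_trig; last first.
    apply/is_trig_mxP => i j lt_ij.
    by rewrite !mxE y0 1?ltnW // -val_eqE /= gtn_eqF // addr0.
  by rewrite big1 // => i _; rewrite !mxE y0 // eqxx addr0.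
have unit1y : (1%:M + y : 'M_n.+1) \is a GRing.unit.
  by change (1%:M + y \in unitmx); rewrite unitmxE det1y unitr1.
exists (FinRing.unit _ unit1y); last by rewrite /GLval /= addrC addKr.
by apply/unitriP => i j le_ji; rewrite /GLval /= !mxE y0 // addr0.
Qed.

Lemma nilset_unitri1P y :
  reflect (forall i j : 'I_n.+1, (j <= i)%N || (i == ord0) -> y i j = 0)
          (y \in nilset (unitri1 F n)).
Proof.
apply: (iffP imsetP) => [[u /unitri1P[/unitriP Uu u0] ->] i j | y0].
  case/orP=> [le_ji | /eqP->]; first by rewrite !mxE Uu // subrr.
  have [|j0] := posnP j; last first.
    by rewrite !mxE u0 // -val_eqE /= ltn_eqF // subrr.
  by move=> j0; rewrite !mxE Uu ?j0 // subrr.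
have /nilset_unitriP/imsetP[u Uu Dy] : forall i j : 'I_n.+1, (j <= i)%N -> y i j = 0.
  by move=> i j le_ji; rewrite y0 // le_ji.
exists u => //; apply/unitri1P; split=> // j lt0j.
have: y ord0 j = 0 by rewrite y0 // eqxx orbT.
by rewrite Dy !mxE -val_eqE /= ltn_eqF // subr0.
Qed.

Lemma delta_unitri y :
  y \in nilset (unitri F n) ->
  forall i j, y i j != 0 -> delta_mx i j \in nilset (unitri F n).
Proof.
move/nilset_unitriP=> y0 i j nzij; apply/nilset_unitriP => a b le_ba.
rewrite mxE; case: andP => // -[/eqP eq_a /eqP eq_b].
by rewrite -eq_a -eq_b y0 ?eqxx in nzij.
Qed.

Lemma delta_unitri1 y :
  y \in nilset (unitri1 F n) ->
  forall i j, y i j != 0 -> delta_mx i j \in nilset (unitri1 F n).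
Proof.
move/nilset_unitri1P=> y0 i j nzij; apply/nilset_unitri1P => a b le_ba.
rewrite mxE; case: andP => // -[/eqP eq_a /eqP eq_b].
by rewrite -eq_a -eq_b y0 ?eqxx in nzij.
Qed.

Definition supchar (C : numClosedFieldType) (theta : F -> C) G lam x : C :=
  #|lorbit G lam|%:R / #|biorbit G lam|%:R *
  \sum_(mu in biorbit G lam) theta (- pairing mu (GLval x - 1%:M)).

End Supercharacters.

Definition nontrivial_addchar (F : finFieldType) (C : numClosedFieldType)
    (theta : F -> C) : Prop :=
  [/\ forall a, theta a != 0,
      forall a b, theta (a + b) = theta a * theta b
    & exists a, theta a != 1].

Section StarProduct.

Variables (F : finFieldType) (n : nat).
Implicit Types (lam mu nu : 'M[F]_n.+1) (i j k l : 'I_n.+1).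

Definition strict_upper lam : bool :=
  [forall i : 'I_n.+1, forall j : 'I_n.+1, (j <= i)%N ==> (lam i j == 0)].

Definition row_sparse lam : bool :=
  [forall i : 'I_n.+1, (#|[set j : 'I_n.+1 | lam i j != 0%R]| <= 1)%N].

Definition col_sparse lam : bool :=
  [forall j : 'I_n.+1, (#|[set i : 'I_n.+1 | lam i j != 0%R]| <= 1)%N].

Definition rook : {set 'M[F]_n.+1} :=
  [set lam | [&& strict_upper lam, row_sparse lam & col_sparse lam]].

Definition setm lam i j (s : F) : 'M[F]_n.+1 :=
  \matrix_(a, b) if (a == i) && (b == j) then s else lam a b.

(* A formal linear combination is encoded by its coefficient function.        *)
Local Notation formal := {ffun 'M[F]_n.+1 -> int}.

Definition single lam : formal := [ffun mu => (mu == lam)%:R].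

(* The recursion decreases k - i; d is a bound on that difference.  The five  *)
(* defining equations are star_diag, ..., star_free below.                     *)
Fixpoint star_rec (d : nat) lam i k : formal :=
  if d isn't d'.+1 then single lam else
  if (k <= i)%N then single lam else
  let i1 : 'I_n.+1 := inord i.+1 in
  if [exists l : 'I_n.+1, (k < l)%N && (lam i l != 0)] then
    star_rec d' lam i1 k *+ #|F|
  else if lam i k != 0 then star_rec d' (setm lam i k 0) i1 k
  else if [pick j : 'I_n.+1 | (i < j < k)%N && (lam i j != 0)] is Some j then
    star_rec d' lam i1 k +
    \sum_(t : F | t != 0) star_rec d' (setm (setm lam i k t) i j 0) i1 j
  else star_rec d' lam i1 k + \sum_(t : F | t != 0) single (setm lam i k t).

Definition star lam i k : formal := star_rec (k - i) lam i k.

Lemma star_rec_enough d1 d2 lam i k :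
  (k - i <= d1)%N -> (k - i <= d2)%N -> star_rec d1 lam i k = star_rec d2 lam i k.
Proof.
elim: d1 d2 lam i k => [|d1 IHd] [|d2] lam i k //=.
- by rewrite leqn0 subn_eq0 => ->.
- by move=> _; rewrite leqn0 subn_eq0 => ->.
move=> le_d1 le_d2; case: leqP => // lt_ik.
have val_i1 : (inord i.+1 : 'I_n.+1) = i.+1 :> nat.
  by rewrite inordK // (leq_ltn_trans lt_ik).
have IH mu (j : 'I_n.+1) : (j <= k)%N ->
    star_rec d1 mu (inord i.+1) j = star_rec d2 mu (inord i.+1) j.
  move=> le_jk; apply: IHd.
    by rewrite val_i1 subnS -subn1 leq_subLR add1n (leq_trans _ le_d1) ?leq_sub2r.
  by rewrite val_i1 subnS -subn1 leq_subLR add1n (leq_trans _ le_d2) ?leq_sub2r.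
rewrite !IH //; case: ifP => // _; case: ifP => // _; case: pickP => // j.
case/andP=> /andP[_ lt_jk] _; congr (_ + _); apply: eq_bigr => t _.
by rewrite IH // ltnW.
Qed.

Lemma star_unfold lam i k : (i < k)%N ->
  star lam i k =
  if [exists l : 'I_n.+1, (k < l)%N && (lam i l != 0)] then
    star lam (inord i.+1) k *+ #|F|
  else if lam i k != 0 then star (setm lam i k 0) (inord i.+1) k
  else if [pick j : 'I_n.+1 | (i < j < k)%N && (lam i j != 0)] is Some j then
    star lam (inord i.+1) k +
    \sum_(t : F | t != 0) star (setm (setm lam i k t) i j 0) (inord i.+1) j
  else star lam (inord i.+1) k + \sum_(t : F | t != 0) single (setm lam i k t).
Proof.
move=> lt_ik.
have val_i1 : (inord i.+1 : 'I_n.+1) = i.+1 :> nat.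
  by rewrite inordK // (leq_ltn_trans lt_ik).
have Dk : (k - i = (k - i.+1).+1)%N by rewrite subnSK.
have E mu : star_rec (k - i.+1) mu (inord i.+1) k = star mu (inord i.+1) k.
  by rewrite /star val_i1.
rewrite {1}/star Dk /= leqNgt lt_ik /= !E.
case: ifP => // _; case: ifP => // _; case: pickP => // j.
case/andP=> /andP[_ lt_jk] _; congr (_ + _); apply: eq_bigr => t _.
by apply: star_rec_enough; rewrite val_i1 // leq_sub2r // ltnW.
Qed.

Lemma row_sparse_eq lam i j l :
  row_sparse lam -> lam i j != 0 -> lam i l != 0 -> j = l.
Proof.
by move/forallP/(_ i)/card_le1_eqP=> H nzj nzl; apply: H; rewrite inE.
Qed.

Lemma star_diag lam i : star lam i i = single lam.
Proof. by rewrite /star subnn. Qed.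

Lemma star_right lam i k l : (i < k)%N -> (k < l)%N -> lam i l != 0 ->
  star lam i k = star lam (inord i.+1) k *+ #|F|.
Proof.
move=> lt_ik lt_kl nzl; rewrite star_unfold //.
by case: existsP => // -[]; exists l; rewrite lt_kl.
Qed.

Lemma star_at lam i k : row_sparse lam -> (i < k)%N -> lam i k != 0 ->
  star lam i k = star (setm lam i k 0) (inord i.+1) k.
Proof.
move=> lam1 lt_ik nzk; rewrite star_unfold // nzk.
case: existsP => // -[l /andP[lt_kl nzl]].
by rewrite (row_sparse_eq lam1 nzk nzl) ltnn in lt_kl.
Qed.

Lemma star_left lam i j k : row_sparse lam -> (i < j < k)%N -> lam i j != 0 ->
  star lam i k =
    star lam (inord i.+1) k +
    \sum_(t : F | t != 0) star (setm (setm lam i k t) i j 0) (inord i.+1) j.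
Proof.
move=> lam1 /andP[lt_ij lt_jk] nzj; rewrite star_unfold ?(ltn_trans lt_ij) //.
case: existsP => [[l /andP[lt_kl nzl]]|_].
  by rewrite -(row_sparse_eq lam1 nzj nzl) ltnNge ltnW in lt_kl.
case: ifPn => [nzk|_]; first by rewrite (row_sparse_eq lam1 nzj nzk) ltnn in lt_jk.
case: pickP => [l /andP[_ nzl]|/(_ j)]; last by rewrite lt_ij lt_jk nzj.
by rewrite (row_sparse_eq lam1 nzl nzj).
Qed.

Lemma star_free lam i k :
  (i < k)%N -> (forall j : 'I_n.+1, (i < j)%N -> lam i j = 0) ->
  star lam i k =
    star lam (inord i.+1) k + \sum_(t : F | t != 0) single (setm lam i k t).
Proof.
move=> lt_ik lam0; rewrite star_unfold //.
case: existsP => [[l /andP[lt_kl]]|_]; first by rewrite lam0 ?eqxx ?(ltn_trans lt_ik).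
rewrite lam0 // eqxx /=; case: pickP => // j /andP[/andP[lt_ij _]].
by rewrite lam0 // eqxx.
Qed.

End StarProduct.

(* The product of the supercharacter attached to mu by chi^{k}, expanded in   *)
(* supercharacters of G.                                                       *)
Definition star_supchar (F : finFieldType) (n : nat) (C : numClosedFieldType)
    (theta : F -> C) (G : {group {'GL_n.+1[F]}}) (mu : 'M[F]_n.+1)
    (i k : 'I_n.+1) (x : {'GL_n.+1[F]}) : C :=
  \sum_nu (star mu i k nu)%:~R * supchar theta G nu x.

(* Main.v *)
(* Fix x in U and put X = x - 1. Averaging over the right action of U turns    *)
(* chi^lam(x) into a sum over the left orbit U lam of a product, over the      *)
(* columns d of mu, of the weight of d in column j: theta(-(X^T d)_j) if       *)
(* (X^T d)_l = 0 for all l < j, and 0 otherwise. For a rook matrix lam the     *)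
(* left orbit is a product of affine spaces, one per column, so chi^lam(x) is  *)
(* a product of column sums S_ij(a) over the nonzero entries a = lam_ij, where *)
(* d runs over the vectors supported in [i, j) with d_i = a.                   *)
(* Let T_ij be the sum of the weights over all d supported in [i, j), so that  *)
(* T_ij is the sum of S_ij(a) over all a and S_ij(0) = T_(i+1)j. If r_i = 1,   *)
(* r_m = 0 for m < i and (X^T r)_l = 0 for l <= j, translation by multiples of *)
(* r shows S_ij(a) = T_(i+1)j for every a. Such an r exists as soon as         *)
(* S_il(s) <> 0 for some l > j and s <> 0; this yields, by recursion on i,     *)
(* that chi^lam *_i chi^{k} = chi^lam T_ik when column k of lam vanishes. For  *)
(* x in U_(n-1) the first unit vector is such an r for the first row, hence    *)
(* S_1k(a) = T_2k.                                                             *)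

Require Import Defs.
From mathcomp Require Import all_boot all_order all_algebra all_fingroup.

Set Implicit Arguments.
Unset Strict Implicit.
Unset Printing Implicit Defensive.

Import GRing.Theory Num.Theory.
Local Open Scope ring_scope.

(** In the notation above the weight is [colfun], T is [colsum] and S is [colsum_at]. Orthogonality
    of characters ([sum_char_nilset]) absorbs the right action and gives [supchar_lorbit];
    [lorbit_rook] splits the left orbit by columns, whence the product formula [supchar_rook]. The
    star recursion mirrors T_ik = T_(i+1)k + (sum of S_ik(t) over t <> 0). When row i is already
    occupied, [colsum_at_neq0] supplies the missing exchange identity; this is [expand_star]. For
    the restriction, with rows numbered from 0, a nonzero entry in position (0, k) contributes the
    factor T_1k by [colsum_at_shift]. The star product erases that entry and continues from row 1
    with column k empty, so [expand_star] produces the same factor. [supchar_unitri1] identifies the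
    supercharacters of the two groups for matrices with zero first row, which also settles the case
    of an empty first row. *)

(** * Weighted sums over the vectors allowed in one column *)

Section ColumnSums.

Variables (F : finFieldType) (C : numClosedFieldType) (theta : F -> C).
Hypothesis theta_char : nontrivial_addchar theta.
Variables (n : nat) (X : 'M[F]_n.+1).
Hypothesis X_upper : X \in nilset (unitri F n).
Implicit Types (d c r : 'cV[F]_n.+1) (i j k l m : 'I_n.+1) (a s t : F).

Lemma addchar0 : theta 0 = 1.
Proof.
case: theta_char => nz thetaD _; apply: (mulfI (nz 0)).
by rewrite -thetaD addr0 mulr1.
Qed.

Lemma addcharD : {morph theta : a b / a + b >-> a * b}.
Proof. by case: theta_char. Qed.

Definition colfun j d : C :=
  [forall l : 'I_n.+1, (l < j)%N ==> ((X^T *m d) l 0 == 0)]%:R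
  * theta (- (X^T *m d) j 0).

Definition csupp (i j : nat) d : bool :=
  [forall m : 'I_n.+1, ~~ (i <= m < j)%N ==> (d m 0 == 0)].

Lemma csuppP (i j : nat) d :
  reflect (forall m, ~~ (i <= m < j)%N -> d m 0 = 0) (csupp i j d).
Proof.
apply: (iffP forallP) => [H m nm | H m]; first by apply/eqP/(implyP (H m)).
by apply/implyP => nm; apply/eqP/H.
Qed.

(** The lower end is a [nat], so that [i.+1] can be used without [inord]. *)
Definition colsum (i : nat) j : C := \sum_(d | csupp i j d) colfun j d.

Definition colsum_at i j a : C :=
  \sum_(d | csupp i j d && (d i 0 == a)) colfun j d.

Lemma colfun0 j : colfun j 0 = 1.
Proof.
rewrite /colfun mulmx0 mxE oppr0 addchar0 mulr1.
by case: forallP => // -[] l; rewrite mxE eqxx implybT.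
Qed.

Lemma eq_colfun j d1 d2 :
  (forall l, (l <= j)%N -> (X^T *m d1) l 0 = (X^T *m d2) l 0) ->
  colfun j d1 = colfun j d2.
Proof.
move=> E; rewrite /colfun E //; congr (_%:R * _); congr nat_of_bool.
by apply: eq_forallb => l; case: (ltnP l j) => //= /ltnW/E->.
Qed.

Lemma colsum_diag j : colsum j j = 1.
Proof.
rewrite /colsum (big_pred1 0) ?colfun0 // => d; apply/csuppP/eqP => [d0 | -> m _].
  by apply/colP => m; rewrite mxE d0 //; case: leqP.
by rewrite mxE.
Qed.

Lemma colsum_split i j : colsum i j = \sum_a colsum_at i j a.
Proof.
by rewrite /colsum (partition_big (fun d => d i 0) predT).
Qed.

Lemma colsum_at0 i j : colsum_at i j 0 = colsum i.+1 j.
Proof.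
apply: eq_bigl => d; apply/andP/csuppP => [[/csuppP d0 /eqP di] m | d0].
  rewrite ltn_neqAle -andbA negb_and negbK => /orP[/eqP/val_inj<- //|].
  exact: d0.
split; last by rewrite d0 // ltnn.
apply/csuppP => m nm; apply: d0; apply: contra nm => /andP[/ltnW-> ->].
by [].
Qed.

Lemma colsum_recl i j :
  colsum i j = colsum i.+1 j + \sum_(a | a != 0) colsum_at i j a.
Proof. by rewrite colsum_split (bigD1 0) //= colsum_at0. Qed.

(* Translation by multiples of r, cut off below row j, preserves colfun.       *)
Lemma colsum_at_shift i j a r : (i < j)%N -> r i 0 = 1 ->
    (forall m, (m < i)%N -> r m 0 = 0) ->
    (forall l, (l <= j)%N -> (X^T *m r) l 0 = 0) ->
  colsum_at i j a = colsum i.+1 j.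
Proof.
move=> lt_ij ri r0 Xr.
(* The translation must preserve supports inside [i, j). Clearing the rows m >= j is harmless: for l
   <= j they enter (X^T r)_l with the coefficient X m l = 0. *)
pose r' : 'cV[F]_n.+1 := \col_m if (m < j)%N then r m 0 else 0.
have Xr' l : (l <= j)%N -> (X^T *m r') l 0 = 0.
  move=> le_lj; rewrite -[RHS](Xr l le_lj) !mxE; apply: eq_bigr => m _.
  rewrite !mxE; case: ltnP => // le_jm.
  by rewrite (nilset_unitriP _ X_upper) ?mul0r // (leq_trans le_lj).
rewrite /colsum_at (reindex (fun d => d + a *: r')) /=; last first.
  by exists (fun d => d - a *: r') => d _; rewrite ?addrK ?subrK.
apply: eq_big => [d | d _]; last first.
  apply: eq_colfun => l le_lj.
  by rewrite mulmxDr -scalemxAr [LHS]mxE [X in _ + X]mxE Xr' // mulr0 addr0.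
have r'i : r' i 0 = 1 by rewrite mxE lt_ij.
have r'0 m : ~~ (i <= m < j)%N -> r' m 0 = 0.
  by rewrite mxE; case: (ltnP m j) => //; rewrite andbT -ltnNge => _ /r0.
rewrite !mxE lt_ij ri mulr1 -[X in _ == X]add0r (inj_eq (addIr a)).
apply/andP/csuppP => [[/csuppP d0 /eqP di] m | d0].
  rewrite ltn_neqAle -andbA negb_and negbK => /orP[/eqP/val_inj<- //|nm].
  by have:= d0 m nm; rewrite mxE [X in _ + X]mxE r'0 // mulr0 addr0.
split; last by rewrite d0 // ltnn.
apply/csuppP => m nm; rewrite mxE [X in _ + X]mxE r'0 // mulr0 addr0.
by apply: d0; apply: contra nm => /andP[/ltnW-> ->].
Qed.

(* A nonzero term of colsum_at i l s provides, up to scaling, a vector r by    *)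
(* which colsum_at_shift applies to all columns j < l.                         *)
Lemma colsum_at_neq0 i j l s t : (i < j)%N -> (j < l)%N -> s != 0 ->
  colsum_at i l s != 0 -> colsum_at i j t = colsum i.+1 j.
Proof.
move=> lt_ij lt_jl nz_s nz.
have /existsP[d /and3P[/csuppP d0 /eqP di nzd]] :
    [exists d, [&& csupp i l d, d i 0 == s & colfun l d != 0]].
  apply: contraNT nz; rewrite negb_exists => /forallP H.
  rewrite /colsum_at big1 // => d /andP[sd di]; apply/eqP.
  by have:= H d; rewrite sd di /= negbK.
have /forallP Xd : [forall m : 'I_n.+1, (m < l)%N ==> ((X^T *m d) m 0 == 0)].
  by apply: contraNT nzd => /negPf E; rewrite /colfun E mul0r.
apply: (@colsum_at_shift _ _ _ (s^-1 *: d)) => //.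
- by rewrite mxE di mulVf.
- by move=> m lt_mi; rewrite mxE d0 ?mulr0 // leqNgt lt_mi.
move=> m le_mj; rewrite -scalemxAr mxE.
by rewrite (eqP (implyP (Xd m) (leq_ltn_trans le_mj lt_jl))) mulr0.
Qed.

(* For c = a e_i these are the vectors a e_i + (span of e_m, i < m < j).        *)
Definition colfree j c : pred 'cV[F]_n.+1 := fun d =>
  [forall m : 'I_n.+1,
    ~~ [exists i : 'I_n.+1, (i < m < j)%N && (c i 0 != 0)] ==> (d m 0 == c m 0)].

Definition colfactor j c : C := \sum_(d | colfree j c d) colfun j d.

(** For a rook matrix this is the value of chi^lam at 1 + X, by [supchar_rook]. *)
Definition colprod (lam : 'M[F]_n.+1) : C := \prod_j colfactor j (col j lam).

Lemma colfactor0 j : colfactor j 0 = 1.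
Proof.
rewrite /colfactor (big_pred1 0) ?colfun0 // => d.
apply/forallP/eqP => [H | -> m]; last by rewrite eqxx implybT.
apply/colP => m; apply/eqP/(implyP (H m)).
by apply/existsPn => i; rewrite mxE eqxx andbF.
Qed.

Lemma colfactor_delta i j a : (i < j)%N -> a != 0 ->
  colfactor j (a *: delta_mx i 0) = colsum_at i j a.
Proof.
move=> lt_ij nz_a; apply: eq_bigl => d.
have E p : (a *: delta_mx i 0 : 'cV[F]_n.+1) p 0 = if p == i then a else 0.
  by rewrite !mxE eqxx andbT; case: eqP; rewrite ?mulr1 ?mulr0.
have Eex m : [exists p : 'I_n.+1, (p < m < j)%N
    && ((a *: delta_mx i 0 : 'cV[F]_n.+1) p 0 != 0)] = (i < m < j)%N.
  apply/existsP/idP => [[p /andP[lt_pmj]] | lt_imj].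
    by rewrite E; case: (p =P i) => [<- //|]; rewrite eqxx.
  by exists i; rewrite E eqxx lt_imj.
apply/forallP/andP => [H | [/csuppP d0 /eqP di] m].
  have {}H m : ~~ (i < m < j)%N -> d m 0 = if m == i then a else 0.
    by move=> nm; move: (H m); rewrite Eex nm E => /eqP.
  split; last by rewrite H ?ltnn // eqxx.
  apply/csuppP => m nm; rewrite H.
    case: (m =P i) => // mi; by rewrite mi leqnn lt_ij in nm.
  by apply: contra nm => /andP[/ltnW-> ->].
rewrite Eex E; apply/implyP => nm; apply/eqP; case: (m =P i) => [-> //|/eqP ne_mi].
apply: d0; apply: contra nm => /andP[le_im ->]; rewrite andbT ltn_neqAle le_im.
by rewrite andbT eq_sym.
Qed.

(** Only the factor of column k changes: an empty column contributes 1, a single entry t in row i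
    contributes S_ik(t). *)
Lemma colprod_setm lam i k t : (i < k)%N -> t != 0 -> col k lam = 0 ->
  colprod (setm lam i k t) = colprod lam * colsum_at i k t.
Proof.
move=> lt_ik nz_t lam_k.
rewrite /colprod (bigD1 k) //= [in RHS](bigD1 k) //= lam_k colfactor0 mul1r mulrC.
congr (_ * _).
  apply: eq_bigr => j ne_jk; congr (colfactor _ _).
  by apply/colP => m; rewrite !mxE (negPf ne_jk) andbF.
rewrite -colfactor_delta //; congr (colfactor _ _).
apply/colP => m; rewrite !mxE !eqxx !andbT.
have /colP/(_ m) := lam_k; rewrite !mxE => ->.
by case: eqP; rewrite ?mulr1 ?mulr0.
Qed.

End ColumnSums.

(** * Orbit sums and character sums *)

(** All fibres of g |-> [to x g] over the orbit are translates of the one over [to x 1]. No identity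
    law is assumed: [act] with trivial group elements truncates a matrix to its strictly upper
    part. *)
Lemma sum_orbit (gT : finGroupType) (T : finType) (C : pzSemiRingType)
    (G : {group gT}) (to : T -> gT -> T) (x : T) (f : T -> C) :
    {in G &, forall g h, to (to x g) h = to x (g * h)%g} ->
  #|[set to x g | g in G]|%:R * \sum_(g in G) f (to x g) =
  #|G|%:R * \sum_(y in [set to x g | g in G]) f y.
Proof.
move=> toM; set O := [set to x g | g in G].
pose c := #|[set g in G | to x g == to x 1%g]|.
have fiber y : y \in O -> #|[set g in G | to x g == y]| = c.
  case/imsetP=> h Gh ->; rewrite -(card_imset _ (mulIg h^-1%g)).
  apply: eq_card => g; rewrite inE; apply/imsetP/andP.
    case=> g' /[!inE] /andP[Gg' /eqP E] ->; rewrite groupM ?groupV //.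
    by rewrite -toM ?groupV // E toM ?groupV // mulgV.
  case=> Gg /eqP E; exists (g * h)%g; last by rewrite mulgK.
  by rewrite inE groupM // -toM // E toM ?group1 // mul1g eqxx.
rewrite (partition_big_imset (to x)) -/O.
have -> : \sum_(y in O) \sum_(g in G | to x g == y) f (to x g) =
          c%:R * \sum_(y in O) f y.
  rewrite mulr_sumr; apply: eq_bigr => y Oy.
  under eq_bigr => g /andP[_ /eqP->] do [].
  by rewrite sumr_const -(fiber y Oy) cardsE mulr_natl.
rewrite mulrA -natrM; congr (_%:R * _).
rewrite -[in RHS]sum1_card (partition_big_imset (to x)) -/O -sum_nat_const.
apply: eq_bigr => y Oy; rewrite -(fiber y Oy) -sum1_card.
by apply: eq_bigl => g; rewrite inE.
Qed.

Lemma big_setX (R : Type) (idx : R) (op : Monoid.com_law idx) (S T : finType)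
    (A : {set S}) (B : {set T}) (f : S * T -> R) :
  \big[op/idx]_(p in setX A B) f p =
  \big[op/idx]_(a in A) \big[op/idx]_(b in B) f (a, b).
Proof.
rewrite (pair_big (mem A) (mem B) (fun a b => f (a, b))) /=.
by apply: eq_big => [[a b] | [a b] //]; rewrite in_setX.
Qed.

Section Fourier.

Variables (F : finFieldType) (C : numClosedFieldType) (theta : F -> C).
Hypothesis theta_char : nontrivial_addchar theta.
Variable n : nat.
Local Notation gT := ({'GL_n.+1[F]} : finGroupType).
Implicit Types (lam mu B X y : 'M[F]_n.+1) (u v x : gT).

(* The group operations inferred on the bare type {'GL_n.+1[F]} and those      *)
(* inferred from its finGroupType structure gT are convertible, but comparing  *)
(* them can take minutes; rewriting with these two lemmas avoids that.         *)
Lemma GL_valV u : GLval u^-1%g = invmx (GLval u).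
Proof. by []. Qed.

Lemma GL_valM u v : GLval (u * v)%g = GLval u *m GLval v.
Proof. by []. Qed.

Lemma pairingD lam : {morph pairing lam : a b / a + b}.
Proof.
move=> a b; rewrite /pairing -big_split; apply: eq_bigr => i _ /=.
by rewrite -big_split; apply: eq_bigr => j _ /=; rewrite mxE mulrDr.
Qed.

Lemma pairing_delta lam (i j : 'I_n.+1) : pairing lam (delta_mx i j) = lam i j.
Proof.
rewrite /pairing (bigD1 i) //= (bigD1 j) //= mxE !eqxx mulr1.
rewrite [X in _ + X + _]big1 => [|l ne]; last by rewrite mxE (negPf ne) andbF mulr0.
rewrite big1 ?addr0 // => k ne.
by rewrite big1 // => l _; rewrite mxE (negPf ne) mulr0.
Qed.

Lemma pairingZ lam a y : pairing lam (a *: y) = a * pairing lam y.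
Proof.
rewrite /pairing mulr_sumr; apply: eq_bigr => i _.
by rewrite mulr_sumr; apply: eq_bigr => j _; rewrite mxE mulrCA.
Qed.

Lemma pairing_mulmx mu X y : pairing mu (X *m y) = pairing (X^T *m mu) y.
Proof.
rewrite /pairing.
under eq_bigr => i _ do under eq_bigr => j _ do rewrite mxE mulr_sumr.
under [RHS]eq_bigr => i _ do under eq_bigr => j _ do rewrite mxE mulr_suml.
under eq_bigr => i _ do rewrite exchange_big /=.
rewrite exchange_big /=; apply: eq_bigr => l _.
rewrite exchange_big /=; apply: eq_bigr => j _; apply: eq_bigr => i _.
by rewrite mxE mulrA; congr (_ * _); rewrite mulrC.
Qed.

(** The summand is a character of the additive group [nilset], trivial exactly when B vanishes
    strictly above the diagonal. *)
Lemma sum_char_nilset B :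
  \sum_(y in nilset (unitri F n)) theta (- pairing B y) =
  #|nilset (unitri F n)|%:R *
  [forall j : 'I_n.+1, forall l : 'I_n.+1, (l < j)%N ==> (B l j == 0)]%:R.
Proof.
case: forallP => [H | nH].
  rewrite mulr1 -sum1_card natr_sum; apply: eq_bigr => y /nilset_unitriP y0.
  rewrite /pairing big1 ?oppr0 ?(addchar0 theta_char) // => l _.
  rewrite big1 // => j _; case: (ltnP l j) => [lt_lj | /y0->]; last by rewrite mulr0.
  by rewrite (eqP (implyP (forallP (H j) l) lt_lj)) mul0r.
have /existsP[j /existsP[l /andP[lt_lj nzB]]] :
    [exists j : 'I_n.+1, exists l : 'I_n.+1, (l < j)%N && (B l j != 0)].
  apply: contraPT nH => /existsPn H [] j; apply/forallP => l; apply/implyP => lt_lj.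
  by have /existsPn/(_ l) := H j; rewrite lt_lj negbK.
rewrite mulr0.
have [_ _ [a nt_a]] := theta_char.
(* Scaled so that [pairing B z] = - a; translation by z then multiplies the sum by [theta a], which
   is not 1. *)
pose z : 'M[F]_n.+1 := - (a / B l j) *: delta_mx l j.
have Nz : z \in nilset (unitri F n).
  apply/nilset_unitriP => p q le_qp; rewrite !mxE.
  case: (p =P l) => [pl|_]; last by rewrite mulr0.
  case: (q =P j) => [qj|_]; last by rewrite mulr0.
  by rewrite pl qj leqNgt lt_lj in le_qp.
set S := \sum_(y in _) _.
have : S = theta a * S.
  rewrite {1}/S (reindex (fun y => y + z)) /=; last first.
    by exists (fun y => y - z) => y _; rewrite ?addrK ?subrK.
  rewrite /S mulr_sumr; apply: eq_big => [y | y _].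
    apply/nilset_unitriP/nilset_unitriP => y0 p q le_qp.
      by have := y0 p q le_qp; rewrite mxE [X in _ + X](nilset_unitriP _ Nz) // addr0.
    by rewrite mxE y0 // (nilset_unitriP _ Nz) // addr0.
  rewrite pairingD opprD (addcharD theta_char) mulrC; congr (theta _ * _).
  by rewrite pairingZ pairing_delta mulNr opprK divfK.
move/eqP; rewrite -subr_eq0 -{1}[S]mul1r -mulrBl mulf_eq0 subr_eq0 eq_sym.
by rewrite (negPf nt_a) => /eqP.
Qed.

Lemma sum_GLval_nilset (G : {group {'GL_n.+1[F]}}) (f : 'M[F]_n.+1 -> C) :
  \sum_(u in G) f (GLval u - 1%:M) = \sum_(y in nilset G) f y.
Proof.
rewrite /nilset big_imset //= => u v _ _ /addIr.
exact: (@val_inj _ _ (FinRing.unit_of 'M[F]_n.+1)).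
Qed.

Lemma nilset_mulr X v :
  X \in nilset (unitri F n) -> v \in unitri F n ->
  X *m GLval v \in nilset (unitri F n).
Proof.
move=> /nilset_unitriP X0 /unitriP Uv; apply/nilset_unitriP => i j le_ji.
rewrite mxE big1 // => k _; case: (leqP k i) => [/X0->|lt_ik]; first by rewrite mul0r.
by rewrite Uv ?(leq_trans le_ji (ltnW lt_ik)) // -val_eqE /= gtn_eqF ?mulr0 //
  (leq_ltn_trans le_ji).
Qed.

Lemma unitri_mull u y :
  u \in unitri F n -> y \in nilset (unitri F n) ->
  GLval u *m y \in nilset (unitri F n).
Proof.
move=> /unitriP Uu /nilset_unitriP y0; apply/nilset_unitriP => i j le_ji.
rewrite mxE big1 // => k _; case: (leqP j k) => [/y0->|lt_kj]; first by rewrite mulr0.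
have lt_ki := leq_trans lt_kj le_ji.
by rewrite Uu ?(ltnW lt_ki) // -val_eqE /= gtn_eqF ?mul0r.
Qed.

Lemma pairing_act_unitri u v lam y :
  y \in nilset (unitri F n) ->
  pairing (Defs.act (unitri F n) u lam v) y =
  pairing lam (invmx (GLval u) *m y *m invmx (GLval v)).
Proof. by move=> Ny; apply: pairing_act; apply: delta_unitri. Qed.

Lemma eq_act_unitri u v u1 v1 lam mu :
  (forall y, y \in nilset (unitri F n) ->
    pairing lam (invmx (GLval u) *m y *m invmx (GLval v))
      = pairing mu (invmx (GLval u1) *m y *m invmx (GLval v1))) ->
  Defs.act (unitri F n) u lam v = Defs.act (unitri F n) u1 mu v1.
Proof.
by move=> E; apply/matrixP => i j; rewrite !mxE; case: ifP => // /E.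
Qed.

Lemma act_unitriM u v u1 v1 lam :
    u \in unitri F n -> v \in unitri F n ->
    u1 \in unitri F n -> v1 \in unitri F n ->
  Defs.act (unitri F n) u1 (Defs.act (unitri F n) u lam v) v1 =
  Defs.act (unitri F n) (u1 * u)%g lam (v * v1)%g.
Proof.
move=> Uu Uv Uu1 Uv1; apply: eq_act_unitri => y Ny.
have N1 : GLval u1^-1 *m y *m GLval v1^-1 \in nilset (unitri F n).
  by apply: nilset_mulr; [apply: unitri_mull; first exact: groupVr|exact: groupVr].
rewrite (pairing_act_unitri _ _ _ N1) -!GL_valV !invMg !GL_valM !mulmxA //.
Qed.

End Fourier.

(** * Supercharacters as sums over left orbits *)

Section Factorization.

Variables (F : finFieldType) (C : numClosedFieldType) (theta : F -> C).
Hypothesis theta_char : nontrivial_addchar theta.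
Variable n : nat.
Local Notation gT := ({'GL_n.+1[F]} : finGroupType).
Implicit Types (lam mu X y : 'M[F]_n.+1) (u v x : gT).

Local Notation U := (unitri F n).

Lemma prod_colfun X mu :
  \prod_j colfun theta X j (col j mu) =
  [forall j : 'I_n.+1, forall l : 'I_n.+1,
    (l < j)%N ==> ((X^T *m mu) l j == 0)]%:R * theta (- pairing mu X).
Proof.
have E j l : (X^T *m col j mu) l 0 = (X^T *m mu) l j by rewrite colE mulmxA -colE mxE.
rewrite /colfun big_split /=; congr (_ * _).
  case: (boolP [forall j, _]) => [/forallP H | ].
    rewrite big1 // => j _; case: forallP => // -[] l.
    by rewrite E; apply: (forallP (H j)).
  rewrite negb_forall => /existsP[j nj]; rewrite (bigD1 j) //=.
  suff /negPf-> : ~~ [forall l : 'I_n.+1, (l < j)%N ==> ((X^T *m col j mu) l 0 == 0)].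
    by rewrite mul0r.
  by apply: contra nj => /forallP H; apply/forallP => l; rewrite -E.
rewrite -(big_morph _ (addcharD theta_char) (addchar0 theta_char)) sumrN.
congr (theta _); congr (- _).
rewrite /pairing exchange_big /=; apply: eq_bigr => j _; rewrite E mxE.
by apply: eq_bigr => m _; rewrite mxE mulrC.
Qed.

(** After v is replaced by its inverse, the functional takes the value mu(X v) = mu(X) + mu(X (v -
    1)). Moving X to mu as X^T leaves a character sum over v - 1, which forces X^T mu to vanish
    strictly above the diagonal. *)
Lemma sum_act_right u lam X :
    u \in U -> X \in nilset U ->
  \sum_(v in U) theta (- pairing (Defs.act U u lam v) X) =
  #|U|%:R * \prod_j colfun theta X j (col j (Defs.act U u lam 1%g)).
Proof.
move=> Uu NX; set mu := Defs.act U u lam 1%g.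
have E v : v \in U -> pairing (Defs.act U u lam v^-1%g) X =
    pairing mu X + pairing (X^T *m mu) (GLval v - 1%:M).
  move=> Uv; rewrite -pairing_mulmx -pairingD -[in RHS](mulmx1 X) -mulmxA mul1mx.
  rewrite -mulmxDr [X in _ *m X]addrC subrK.
  rewrite /mu !pairing_act_unitri ?nilset_mulr //.
  by rewrite -[invmx (GLval v^-1%g)]GL_valV invgK GL_1E invmx1 mulmx1 mulmxA.
rewrite (reindex_inj invg_inj) /=.
rewrite (eq_bigl (mem U)) => [|v]; last by rewrite -[RHS](groupV U).
under eq_bigr => v Uv do rewrite E // opprD (addcharD theta_char).
rewrite -mulr_sumr (sum_GLval_nilset U (fun y => theta (- pairing (X^T *m mu) y))).
rewrite (sum_char_nilset theta_char) prod_colfun.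
have -> : #|nilset U| = #|U|.
  apply: card_in_imset => v w _ _ /addIr.
  exact: (@val_inj _ _ (FinRing.unit_of 'M[F]_n.+1)).
by rewrite mulrC mulrA.
Qed.

(** Both orbit sums become group sums by [sum_orbit]; the orbit sizes this introduces cancel the
    normalizing factor of the supercharacter. *)
Lemma supchar_lorbit lam x : x \in U ->
  supchar theta U lam x =
  \sum_(mu in lorbit U lam)
     \prod_j colfun theta (GLval x - 1%:M) j (col j mu).
Proof.
move=> Ux; set X := GLval x - 1%:M.
have NX : X \in nilset U by apply: imset_f.
pose f mu : C := theta (- pairing mu X).
pose h mu := \prod_j colfun theta X j (col j mu).
(* Inverting the left factor turns the two-sided action into a right action, as [sum_orbit]
   requires. *)
pose to mu (g : gT * gT) := Defs.act U g.1^-1%g mu g.2.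
pose to1 mu u := Defs.act U u^-1%g mu 1%g.
have toM : {in setX U U &, forall g k, to (to lam g) k = to lam (g * k)%g}.
  move=> [u v] [u' v'] /setXP[Uu Uv] /setXP[Uu' Uv'].
  by rewrite /to /= (act_unitriM _ (groupVr Uu) Uv (groupVr Uu') Uv') -invMg.
have to1M : {in U &, forall g k, to1 (to1 lam g) k = to1 lam (g * k)%g}.
  move=> u u' Uu Uu'; rewrite /to1 /=.
  by rewrite act_unitriM ?groupV // -invMg mulg1.
have DB : biorbit U lam = [set to lam g | g in setX U U].
  apply/setP => mu; apply/imset2P/imsetP.
    case=> u v Uu Uv ->; exists ((u : gT)^-1%g, v); last by rewrite /to /= invgK.
    by apply/setXP; split=> //; apply: groupVr.
  case=> -[u v] /setXP[Uu Uv] ->; exists (u : gT)^-1%g v => //.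
  exact: (@groupVr _ U).
have DL : lorbit U lam = [set to1 lam u | u in U].
  apply/setP => mu; apply/imsetP/imsetP => [] [u Uu ->]; exists (u : gT)^-1%g;
    by rewrite /to1 ?invgK //; apply: groupVr.
have sumB := sum_orbit f toM; have sumL := sum_orbit h to1M.
rewrite -DB in sumB; rewrite -DL in sumL.
have Eg : \sum_(g in setX U U) f (to lam g) =
          #|U|%:R * \sum_(u in U) h (to1 lam u).
  rewrite big_setX mulr_sumr.
  by apply: eq_bigr => u Uu; rewrite (sum_act_right _ (groupVr Uu) NX).
rewrite Eg cardsX natrM -mulrA in sumB.
have nzU : #|U|%:R != 0 :> C by rewrite pnatr_eq0 -lt0n cardG_gt0.
have nzB : #|biorbit U lam|%:R != 0 :> C.
  rewrite pnatr_eq0 -lt0n; apply/card_gt0P.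
  by exists (Defs.act U 1%g lam 1%g); apply: imset2_f.
rewrite /supchar -/X -[\sum_(mu in biorbit _ _) _]/(\sum_(mu in biorbit _ _) f mu).
apply: (mulfI nzU); rewrite -sumL.
rewrite [LHS]mulrCA -[in LHS]mulrA; congr (_ * _).
apply: (mulfI nzB); rewrite mulVKf //; apply: (mulfI nzU).
by rewrite mulrA mulrCA -mulrA -[LHS]sumB mulrCA.
Qed.

End Factorization.

(** * Left orbits of rook matrices and the product formula *)

Section Rook.

Variables (F : finFieldType) (n : nat).
Implicit Types (lam mu X y : 'M[F]_n.+1) (i j k l m : 'I_n.+1).

Local Notation gT := ({'GL_n.+1[F]} : finGroupType).
Local Notation U := (unitri F n).

Lemma rookP lam :
  reflect [/\ forall i j, lam i j != 0 -> (i < j)%N,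
              forall i j l, lam i j != 0 -> lam i l != 0 -> j = l
            & forall i l j, lam i j != 0 -> lam l j != 0 -> i = l]
          (lam \in rook F n).
Proof.
rewrite inE; apply: (iffP and3P) => [[/forallP su /forallP rs /forallP cs] | [su rs cs]].
  split=> [i j nz | i j l nzj nzl | i l j nzi nzl].
  - rewrite ltnNge; apply: contra nz => le_ji.
    exact: (implyP (forallP (su i) j)).
  - by have /card_le1_eqP := rs i; apply; rewrite inE.
  - by have /card_le1_eqP := cs j; apply; rewrite inE.
split; apply/forallP => i.
- apply/forallP => j; apply/implyP => le_ji.
  by apply/negPn; apply/negP => /su; rewrite ltnNge le_ji.
- by apply/card_le1_eqP => j l /[!inE] nzj nzl; rewrite (rs _ _ _ nzj nzl).
- by apply/card_le1_eqP => j l /[!inE] nzj nzl; rewrite (cs _ _ _ nzj nzl).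
Qed.

Lemma delta_nilset i j : (delta_mx i j \in nilset U) = (i < j)%N.
Proof.
apply/nilset_unitriP/idP => [d0 | lt_ij p q le_qp].
  rewrite ltnNge; apply/negP => /d0/eqP.
  by rewrite mxE !eqxx oner_eq0.
rewrite mxE; case: andP => // -[/eqP pi /eqP qj].
by move: le_qp; rewrite pi qj leqNgt lt_ij.
Qed.

Lemma mulmx_delta (A B : 'M[F]_n.+1) i j p q :
  (A *m delta_mx i j *m B) p q = A p i * B j q.
Proof.
rewrite mxE (bigD1 j) //= big1 ?addr0 => [|k ne]; last first.
  rewrite mxE big1 ?mul0r // => l _.
  by rewrite mxE (negPf ne) andbF mulr0.
rewrite mxE (bigD1 i) //= big1 ?addr0 => [|l ne].
  by rewrite mxE !eqxx mulr1.
by rewrite mxE (negPf ne) mulr0.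
Qed.

Lemma act_unitriE (u v : gT) lam i j :
  Defs.act U u lam v i j =
  if (i < j)%N
  then \sum_p \sum_q lam p q * (invmx (GLval u) p i * invmx (GLval v) j q) else 0.
Proof.
transitivity (if (i < j)%N then
    pairing lam (invmx (GLval u) *m delta_mx i j *m invmx (GLval v)) else 0).
  by rewrite mxE delta_nilset.
case: ifP => // _; rewrite /pairing.
by apply: eq_bigr => p _; apply: eq_bigr => q _; rewrite mulmx_delta.
Qed.

Lemma act_lE (u : gT) lam m j :
  Defs.act U u lam 1%g m j =
  if (m < j)%N then \sum_a lam a j * invmx (GLval u) a m else 0.
Proof.
rewrite act_unitriE; case: ifP => // _; apply: eq_bigr => a _.
rewrite GL_1E invmx1 (bigD1 j) //= big1 ?addr0 => [|k ne].
  by rewrite mxE eqxx mulr1.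
by rewrite mxE eq_sym (negPf ne) !mulr0.
Qed.

Lemma nilset_exists (G : {group gT}) y : y \in nilset G ->
  exists2 u : gT, u \in G & invmx (GLval u) = 1%:M + y.
Proof.
case/imsetP=> u Gu Dy; exists ((u : gT)^-1)%g; first exact: (@groupVr _ G).
by rewrite -GL_valV invgK Dy addrC subrK.
Qed.

(** With w = u^-1, the entry (m, j) of u lam, m < j, is the sum of lam_aj w_am over a. Below the
    nonzero entry lam_ij of its column it equals lam_ij w_im. Since row i has no other nonzero
    entry, the numbers w_im serve column j alone and can be prescribed freely. *)
Lemma lorbit_rook lam mu : lam \in rook F n ->
  (mu \in lorbit U lam) = [forall j, colfree j (col j lam) (col j mu)].
Proof.
move=> /rookP[su rs cs].
(* When no entry of column j above row m is nonzero, a unitriangular w acts    *)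
(* trivially on the entry (m, j).                                              *)
have free (w : 'M[F]_n.+1) m j :
    (forall p q : 'I_n.+1, (q <= p)%N -> w p q = (p == q)%:R) -> (m < j)%N ->
    ~~ [exists i : 'I_n.+1, (i < m < j)%N && (col j lam i 0 != 0)] ->
    \sum_a lam a j * w a m = lam m j.
  move=> Uw lt_mj /existsPn nex.
  rewrite (bigD1 m) //= Uw // eqxx mulr1 big1 ?addr0 // => a ne_am.
  have [lt_am | le_ma] := ltnP a m.
    by have:= nex a; rewrite lt_am lt_mj mxE negbK => /eqP->; rewrite mul0r.
  by rewrite Uw // (negPf ne_am) mulr0.
apply/imsetP/forallP => [[u Uu ->] j | mu_free].
  apply/forallP => m; apply/implyP => nex; rewrite [X in X == _]mxE act_lE [X in _ == X]mxE.
  case: ltnP => [lt_mj | le_jm]; last first.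
    by rewrite eq_sym; apply: contraTT le_jm => /su; rewrite ltnNge.
  apply/eqP/free => // p q le_qp; rewrite -GL_valV.
  by apply: (unitriP _ (@groupVr _ U _ Uu)).
(* At most one j has lam i j <> 0; the other terms vanish because division by 0 gives 0. *)
pose y : 'M[F]_n.+1 := \matrix_(i < n.+1, m < n.+1)
  if (i < m)%N then \sum_(j < n.+1 | (m < j)%N) mu m j / lam i j else 0.
have /nilset_exists[u Uu Du] : y \in nilset U.
  by apply/nilset_unitriP => i j le_ji; rewrite mxE ltnNge le_ji.
have Uw (p q : 'I_n.+1) : (q <= p)%N -> (1%:M + y) p q = (p == q)%:R.
  by move=> le_qp; rewrite !mxE ltnNge le_qp addr0.
exists u => //; apply/matrixP => m j; rewrite act_lE Du.
have {}mu_free := implyP (forallP (mu_free j) m).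
case: ltnP => [lt_mj | le_jm]; last first.
  have /mu_free : ~~ [exists i : 'I_n.+1, (i < m < j)%N && (col j lam i 0 != 0)].
    by apply/existsPn => i; rewrite (ltnNge m) le_jm andbF.
  rewrite !mxE => /eqP->; apply/eqP.
  by apply: contraTT le_jm => /su; rewrite -ltnNge.
have [/existsP[i] | nex] := boolP [exists i : 'I_n.+1, (i < m < j)%N && (col j lam i 0 != 0)].
  rewrite mxE lt_mj andbT => /andP[lt_im nz].
  rewrite (bigD1 i) //= big1 ?addr0 => [|a ne_ai]; last first.
    have [->|/cs/(_ nz) ai] := eqVneq (lam a j) 0; first by rewrite mul0r.
    by rewrite ai eqxx in ne_ai.
  rewrite !mxE lt_im -val_eqE /= ltn_eqF // add0r (bigD1 j) //= big1 ?addr0.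
    by rewrite mulrC divfK.
  move=> l /andP[_ ne_lj]; have [->|/rs/(_ nz) lj] := eqVneq (lam i l) 0.
    by rewrite invr0 mulr0.
  by rewrite lj eqxx in ne_lj.
by rewrite free //; have /eqP:= mu_free nex; rewrite !mxE.
Qed.

Section Product.

Variables (C : numClosedFieldType) (theta : F -> C).
Hypothesis theta_char : nontrivial_addchar theta.

(** The orbit is a product over columns, so the sum of products distributes into a product of
    sums. *)
Lemma supchar_rook lam (x : gT) : lam \in rook F n -> x \in U ->
  supchar theta U lam x = colprod theta (GLval x - 1%:M) lam.
Proof.
move=> lam_rook Ux; rewrite (supchar_lorbit theta_char) //.
set X := GLval x - 1%:M; rewrite /colprod /colfactor bigA_distr_big_dep.
rewrite (reindex (fun mu : 'M[F]_n.+1 => [ffun j => col j mu])) /=; last first.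
  exists (fun f : {ffun 'I_n.+1 -> 'cV[F]_n.+1} => \matrix_(m, j) f j m 0) => [mu|f] _.
    by apply/matrixP => m j; rewrite mxE ffunE mxE.
  by apply/ffunP => j; rewrite ffunE; apply/colP => m; rewrite !mxE.
apply: eq_big => [mu | mu _]; last by apply: eq_bigr => j _; rewrite ffunE.
rewrite lorbit_rook //; apply/forallP/familyP => H j; have:= H j;
  by rewrite ffunE.
Qed.

End Product.

(** * Comparison of the supercharacters of the two groups *)

(** The definitions can differ only in the first row, where the larger group also gives 0: lam has
    zero first row, and u^-1 has zeros below the diagonal of its first column. *)
Lemma act_unitri1 (u v : gT) lam :
    (forall j, lam ord0 j = 0) -> u \in U -> v \in U ->
  Defs.act (unitri1 F n) u lam v = Defs.act U u lam v.
Proof.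
move=> lam0 Uu Uv; apply/matrixP => i j; rewrite !mxE delta_nilset.
have -> : (delta_mx i j \in nilset (unitri1 F n)) = (i < j)%N && (i != ord0).
  apply/nilset_unitri1P/andP => [d0 | [lt_ij nz_i] p q].
    have := d0 i j; rewrite mxE !eqxx ltnNge; case: leqP => //= _.
      by move=> /(_ isT)/eqP; rewrite oner_eq0.
    by case: eqP => // _ /(_ isT)/eqP; rewrite oner_eq0.
  rewrite mxE; case: andP => // -[/eqP-> /eqP->].
  by rewrite leqNgt lt_ij (negPf nz_i).
case: ltnP => //= lt_ij; case: eqP => //= i0.
rewrite /pairing big1 // => p _; rewrite big1 // => q _; rewrite mulmx_delta i0.
have [->|nz_p] := eqVneq p ord0; first by rewrite lam0 mul0r.
rewrite (unitriP _ (@groupVr _ U _ Uu)) //.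
by rewrite (negPf nz_p) mul0r mulr0.
Qed.

Lemma unitri1_lower (u : gT) : u \in U ->
  exists2 u1 : gT, u1 \in unitri1 F n &
    forall i j, i != ord0 -> invmx (GLval u1) i j = invmx (GLval u) i j.
Proof.
move=> Uu; have /unitriP Vu : (u^-1)%g \in U by exact: groupVr.
pose y : 'M[F]_n.+1 :=
  \matrix_(i, j) if i == ord0 then 0 else (invmx (GLval u) - 1%:M) i j.
have /nilset_exists[u1 Uu1 Du1] : y \in nilset (unitri1 F n).
  apply/nilset_unitri1P => i j; rewrite mxE; case: eqP => //= _.
  by rewrite orbF => le_ji; rewrite !mxE -GL_valV Vu // subrr.
exists u1 => // i j /negPf nz_i.
by rewrite Du1 !mxE nz_i addrC subrK.
Qed.

(* The first row of a group element plays no role in its action on a matrix    *)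
(* whose first row is zero, so that the orbits under both groups coincide.     *)
Lemma act_unitri1_surj (u v : gT) lam :
    (forall j, lam ord0 j = 0) -> u \in U -> v \in U ->
  exists u1 v1 : gT, [/\ u1 \in unitri1 F n, v1 \in unitri1 F n,
    Defs.act (unitri1 F n) u1 lam v1 = Defs.act U u lam v
    & Defs.act (unitri1 F n) u1 lam 1%g = Defs.act U u lam 1%g].
Proof.
move=> lam0 Uu Uv.
have [u1 U1u1 Eu1] := unitri1_lower Uu; have [v1 U1v1 Ev1] := unitri1_lower Uv.
have /unitri1P[Uu1 _] := U1u1; have /unitri1P[Uv1 _] := U1v1.
exists u1, v1; split=> //.
  rewrite act_unitri1 //; apply/matrixP => i j; rewrite !act_unitriE.
  case: ifP => // lt_ij; apply: eq_bigr => p _; apply: eq_bigr => q _.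
  have [->|nz_p] := eqVneq p ord0; first by rewrite lam0 !mul0r.
  by rewrite Eu1 // Ev1 // -lt0n (leq_trans _ lt_ij).
rewrite act_unitri1 //.
apply/matrixP => i j; rewrite !act_lE.
case: ifP => // lt_ij; apply: eq_bigr => p _.
have [->|nz_p] := eqVneq p ord0; first by rewrite lam0 !mul0r.
by rewrite Eu1.
Qed.

Lemma supchar_unitri1 (C : numClosedFieldType) (theta : F -> C) lam (x : gT) :
    (forall j, lam ord0 j = 0) ->
  supchar theta (unitri1 F n) lam x = supchar theta U lam x.
Proof.
move=> lam0; have U1U u : u \in unitri1 F n -> u \in U by case/unitri1P.
have EB : biorbit (unitri1 F n) lam = biorbit U lam.
  apply/setP => mu; apply/imset2P/imset2P.
    case=> u v U1u U1v ->; exists u v; [exact: U1U | exact: U1U |].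
    by apply: act_unitri1 => //; apply: U1U.
  case=> u v Uu Uv ->; have [u1 [v1 [U1u1 U1v1 <- _]]] := act_unitri1_surj lam0 Uu Uv.
  by exists u1 v1.
have EL : lorbit (unitri1 F n) lam = lorbit U lam.
  apply/setP => mu; apply/imsetP/imsetP => [] [u Uu ->].
    exists u; first exact: U1U.
    by apply: act_unitri1 => //; exact: U1U.
  have [u1 [v1 [U1u1 _ _ <-]]] := act_unitri1_surj lam0 Uu Uu.
  by exists u1.
by rewrite /supchar EB EL.
Qed.

End Rook.

(** * The star product as multiplication by T_ik *)

Section StarExpansion.

Variables (F : finFieldType) (C : numClosedFieldType) (theta : F -> C).
Hypothesis theta_char : nontrivial_addchar theta.
Variables (n : nat) (X : 'M[F]_n.+1).
Hypothesis X_upper : X \in nilset (unitri F n).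
Implicit Types (lam mu nu : 'M[F]_n.+1) (i j k l m : 'I_n.+1).

Lemma setm_row lam i k (t : F) a : a != i -> row a (setm lam i k t) = row a lam.
Proof. by move=> /negPf ne; apply/rowP => b; rewrite !mxE ne. Qed.

Lemma rook_setm0 lam i j : lam \in rook F n -> setm lam i j 0 \in rook F n.
Proof.
move=> /rookP[su rs cs].
have nz a b : setm lam i j 0 a b != 0 -> lam a b != 0.
  by rewrite mxE; case: ifP => //; rewrite eqxx.
by apply/rookP; split=> [a b /nz/su|a b c /nz + /nz|a b c /nz + /nz] //;
  [apply: rs|apply: cs].
Qed.

Lemma rook_setm lam i k t :
    lam \in rook F n -> (i < k)%N -> row i lam = 0 -> col k lam = 0 ->
  setm lam i k t \in rook F n.
Proof.
move=> /rookP[su rs cs] lt_ik /rowP ri /colP ck.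
have {}ri b : lam i b = 0 by have:= ri b; rewrite !mxE.
have {}ck a : lam a k = 0 by have:= ck a; rewrite !mxE.
have nz a b : setm lam i k t a b != 0 ->
    (a = i /\ b = k) \/ [/\ a != i, b != k & lam a b != 0].
  rewrite mxE; case: (a =P i) => [->|/eqP ne_ai] /=.
    by case: (b =P k) => [->|_]; [left | rewrite ri eqxx].
  case: (b =P k) => [->|/eqP ne_bk]; first by rewrite ck eqxx.
  by right.
apply/rookP; split=> [a b /nz[[-> ->] // | [_ _ /su //]] | a b c | a b c].
- case/nz => [[Ea Eb] | [nai _ nzb]] /nz[[Ea' Ec] | [nai' _ nzc]].
  + by rewrite Eb Ec.
  + by rewrite Ea eqxx in nai'.
  + by rewrite Ea' eqxx in nai.
  + exact: rs nzb nzc.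
case/nz => [[Ea Ec] | [_ nck nza]] /nz[[Eb Ec'] | [_ nck' nzb]].
- by rewrite Ea Eb.
- by rewrite Ec eqxx in nck'.
- by rewrite Ec' eqxx in nck.
- exact: cs nza nzb.
Qed.

Lemma setm_id lam i j : setm lam i j (lam i j) = lam.
Proof. by apply/matrixP => a b; rewrite mxE; case: andP => // -[/eqP-> /eqP->]. Qed.

Lemma setm_setm lam i j s t : setm (setm lam i j s) i j t = setm lam i j t.
Proof. by apply/matrixP => a b; rewrite !mxE; case: (_ && _). Qed.

Lemma setmC lam i j k s t : j != k ->
  setm (setm lam i k t) i j s = setm (setm lam i j s) i k t.
Proof.
move=> /negPf ne_jk; apply/matrixP => a b; rewrite !mxE.
case: (b =P j) => [->|]; last by rewrite andbF.
by rewrite ne_jk !andbF.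
Qed.

Lemma col_setm lam i j k t : k != j -> col k (setm lam i j t) = col k lam.
Proof. by move=> /negPf ne; apply/colP => a; rewrite !mxE ne andbF. Qed.

Lemma col_setm0 lam i j : lam \in rook F n -> lam i j != 0 ->
  col j (setm lam i j 0) = 0.
Proof.
move=> /rookP[_ _ cs] nz; apply/colP => a; rewrite !mxE eqxx andbT.
case: eqP => // ne_ai; apply/eqP; apply: contraPT ne_ai => nza.
by move/(_ (cs _ _ _ nza nz)).
Qed.

Lemma row_setm0 lam i j : lam \in rook F n -> lam i j != 0 ->
  row i (setm lam i j 0) = 0.
Proof.
move=> /rookP[_ rs _] nz; apply/rowP => b; rewrite !mxE eqxx.
case: eqP => // ne_bj; apply/eqP; apply: contraPT ne_bj => nzb.
by move/(_ (rs _ _ _ nzb nz)).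
Qed.

Lemma colprod_split lam i j : lam \in rook F n -> lam i j != 0 ->
  colprod theta X lam =
  colprod theta X (setm lam i j 0) * colsum_at theta X i j (lam i j).
Proof.
move=> rk nz; have [su _ _] := rookP _ rk.
by rewrite -colprod_setm ?su ?col_setm0 // setm_setm setm_id.
Qed.

Definition expand (chi : 'M[F]_n.+1 -> C) (f : {ffun 'M[F]_n.+1 -> int}) : C :=
  \sum_nu (f nu)%:~R * chi nu.

Lemma expandD chi : {morph expand chi : f g / f + g}.
Proof.
move=> f g; rewrite /expand -big_split; apply: eq_bigr => nu _.
by rewrite ffunE rmorphD mulrDl.
Qed.

Lemma expand0 chi : expand chi 0 = 0.
Proof. by rewrite /expand big1 // => nu _; rewrite ffunE mul0r. Qed.

Lemma expandMn chi f q : expand chi (f *+ q) = expand chi f *+ q.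
Proof. by elim: q => [|q IHq]; rewrite ?expand0 // !mulrS expandD IHq. Qed.

Lemma expand_single chi mu : expand chi (single mu) = chi mu.
Proof.
rewrite /expand (bigD1 mu) //= big1 ?addr0 => [|nu /negPf ne].
  by rewrite ffunE eqxx mul1r.
by rewrite ffunE ne mul0r.
Qed.

(** Later instantiated with the supercharacters of [unitri1] at a fixed x. The recursion started at
    a row i > 0 meets only rook matrices with zero first row. *)
Variable chi : 'M[F]_n.+1 -> C.
Hypothesis chiE : forall nu,
  nu \in rook F n -> row ord0 nu = 0 -> chi nu = colprod theta X nu.

(** Induction on k - i along the cases of the star product; an entry in position (i, k) is excluded
    since column k is empty. If row i is empty, the recursion is exactly [colsum_recl]. For an entry
    at j > k one needs T_ik = q T_(i+1)k, and for an entry at j < k one needs S_ij(lam_ij) S_ik(t) =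
    S_ik(t) T_(i+1)j. *)
Lemma expand_star lam i k :
    lam \in rook F n -> row ord0 lam = 0 -> col k lam = 0 -> (0 < i <= k)%N ->
  expand chi (star lam i k) = colprod theta X lam * colsum theta X i k.
Proof.
have [d] := ubnP (k - i); elim: d lam i k => // d IHd lam i k.
rewrite ltnS => le_d rk r0 ck /andP[lt_0i]; rewrite leq_eqVlt.
case/orP=> [/eqP/val_inj-> | lt_ik].
  by rewrite star_diag expand_single chiE // colsum_diag // mulr1.
have val_i1 : (inord i.+1 : 'I_n.+1) = i.+1 :> nat.
  by rewrite inordK // (leq_ltn_trans lt_ik).
have IH mu j : mu \in rook F n -> row ord0 mu = 0 -> col j mu = 0 -> (i < j <= k)%N ->
    expand chi (star mu (inord i.+1) j) = colprod theta X mu * colsum theta X i.+1 j.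
  move=> rk' r0' cj /andP[lt_ij le_jk]; rewrite IHd // ?val_i1 ?lt_ij //.
  by rewrite (leq_trans _ le_d) // subnS prednK ?subn_gt0 // leq_sub2r.
have [su rs cs] := rookP _ rk.
have ck' a : lam a k = 0 by move/colP/(_ a): ck; rewrite !mxE.
have nz_i : ord0 != i by rewrite -val_eqE /= eq_sym -lt0n.
have rowsp : row_sparse lam by move: rk; rewrite inE => /and3P[].
have lt_ikk : (i < k <= k)%N by rewrite lt_ik /=.
have [/existsP[j nzj] | ] := boolP [exists j, lam i j != 0]; last first.
  move/existsPn => ri; have {}ri j : lam i j = 0 by apply/eqP; rewrite -[_ == _]negbK.
  have ri0 : row i lam = 0 by apply/rowP => j; rewrite !mxE.
  rewrite star_free //.
  rewrite expandD IH // (big_morph _ (expandD chi) (expand0 chi)).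
  rewrite (colsum_recl _ _ i k) mulrDr; congr (_ + _).
  rewrite mulr_sumr; apply: eq_bigr => t nz_t.
  rewrite expand_single chiE ?colprod_setm ?setm_row //.
  exact: rook_setm.
have lt_ij := su _ _ nzj.
have [lt_kj | lt_jk | /val_inj jk] := ltngtP k j; last by rewrite -jk ck' eqxx in nzj.
  rewrite (star_right lt_ik lt_kj nzj) expandMn IH //.
  rewrite (colprod_split rk nzj) -!mulrA -mulrnAr; congr (_ * _).
  (* Either the factor of lam_ij vanishes, and with it both sides, or all q sums S_ik(t) equal
     T_(i+1)k. *)
  have [->|nz] := eqVneq (colsum_at theta X i j (lam i j)) 0.
    by rewrite !mul0r mul0rn.
  rewrite (colsum_split _ _ i k).
  under eq_bigr => t _ do rewrite (colsum_at_neq0 X_upper t lt_ik lt_kj nzj nz).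
  by rewrite sumr_const mulrnAr.
have lt_ijk : (i < j < k)%N by rewrite lt_ij lt_jk.
rewrite (star_left rowsp lt_ijk nzj) expandD IH //.
rewrite (big_morph _ (expandD chi) (expand0 chi)).
rewrite (colsum_recl _ _ i k) mulrDr; congr (_ + _).
rewrite (colprod_split rk nzj) -mulrA !mulr_sumr; apply: eq_bigr => t nz_t.
have ne_jk : j != k by rewrite -val_eqE /= ltn_eqF.
(* Erasing (i, j) first empties row i, so that inserting t at (i, k) keeps a rook matrix. *)
rewrite setmC // IH ?lt_ij ?(ltnW lt_jk) //; first last.
- by rewrite col_setm // col_setm0.
- by rewrite !setm_row.
- by rewrite rook_setm ?rook_setm0 ?row_setm0 // col_setm // eq_sym.
rewrite colprod_setm // ?col_setm 1?eq_sym // -mulrA; congr (_ * _).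
(* The same dichotomy, now with column k as the one further right: S_ik(t) <> 0 forces S_ij(lam_ij)
   = T_(i+1)j. *)
have [->|nz] := eqVneq (colsum_at theta X i k t) 0; first by rewrite !(mul0r, mulr0).
by rewrite (colsum_at_neq0 X_upper (lam i j) lt_ij lt_jk nz_t nz) mulrC.
Qed.

End StarExpansion.

(** * The restriction formula *)

Theorem corollary5p1 (F : finFieldType) (C : numClosedFieldType)
    (theta : F -> C) (theta_char : nontrivial_addchar theta)
    (n : nat) (lam : 'M[F]_n.+1) (lam_rook : lam \in rook F n) :
  (forall k : 'I_n.+1, (0 < k)%N -> lam ord0 k != 0 ->
     forall x : {'GL_n.+1[F]}, x \in unitri1 F n ->
       supchar theta (unitri F n) lam x =
       star_supchar theta (unitri1 F n) lam ord0 k x) /\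
  ((forall k : 'I_n.+1, (0 < k)%N -> lam ord0 k = 0) ->
     forall x : {'GL_n.+1[F]}, x \in unitri1 F n ->
       supchar theta (unitri F n) lam x = supchar theta (unitri1 F n) lam x).
Proof.
have [su _ _] := rookP _ lam_rook.
split=> [k lt_0k nz x U1x | r0 x _]; last first.
  rewrite supchar_unitri1 // => j; have [j0 | /r0 //] := posnP j.
  by apply/eqP; apply: contraT => /su; rewrite j0.
have /unitri1P[Ux x0] := U1x.
pose X := GLval x - 1%:M.
have NX : X \in nilset (unitri F n) by apply: imset_f.
have X0 m : X ord0 m = 0.
  have /nilset_unitri1P : X \in nilset (unitri1 F n) by apply: imset_f.
  by apply; rewrite eqxx orbT.
have rowsp : row_sparse lam by move: lam_rook; rewrite inE => /and3P[].
have val_1 : (inord 1 : 'I_n.+1) = 1%N :> nat.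
  by rewrite inordK // (leq_ltn_trans lt_0k).
rewrite (supchar_rook theta_char) // -/X (colprod_split theta_char X lam_rook nz).
(* The first row of X is zero, so X^T kills the first unit vector. *)
rewrite (@colsum_at_shift _ _ _ _ _ NX ord0 k _ (delta_mx ord0 0)) //; first last.
- move=> l _; rewrite mxE big1 // => m _; have [->|/negPf ne] := eqVneq m ord0.
    by rewrite [X^T _ _]mxE X0 mul0r.
  by rewrite [delta_mx _ _ _ _]mxE ne mulr0.
- by rewrite mxE !eqxx.
(* The first step of the recursion meets the entry (0, k) itself; erasing it empties both row 0 and
   column k, as [expand_star] requires. *)
rewrite /star_supchar star_at // -/(expand _ _).
rewrite (expand_star theta_char NX) ?val_1 //; first last.
- by rewrite col_setm0.
- by rewrite row_setm0.
- exact: rook_setm0.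
move=> nu rk /rowP r0; have {}r0 j : nu ord0 j = 0 by have:= r0 j; rewrite !mxE.
by rewrite supchar_unitri1 // (supchar_rook theta_char).
Qed.
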